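(* Let $s\in(0,\infty)$, $r\in\mathbb N$ with $r>s$, $f\in\Lambda_s$, and $\varepsilon,\varepsilon_1\in(0,\infty)$ with $\varepsilon>\varepsilon_1$. Then there exists $\delta\in(0,\infty)$, depending only on $f$, $\varepsilon$, $\varepsilon_1$ (and $s,r,n$), such that for every $j\in\mathbb N$, $$\big[S_{r,j}(s,f,\varepsilon)\big]_\delta\subset S_{r,j-1}(s,f,\varepsilon_1)\cup S_{r,j}(s,f,\varepsilon_1)\cup S_{r,j+1}(s,f,\varepsilon_1).$$
   Context: $\Delta_hf(x):=f(x+h/2)-f(x-h/2)$, $\Delta^{k+1}_h:=\Delta^k_h\Delta_h$, $\Delta_kf(x,y):=\sup_{h\in\mathbb R^n,|h|=y}|\Delta_h^kf(x)|$. $\Lambda_s$: bounded continuous $f$ on $\mathbb R^n$ with $\|f\|_{L^\infty}+\sup_{x\in\mathbb R^n,y\in(0,1]}\Delta_{\lfloor s\rfloor+1}f(x,y)/y^s<\infty$. $S_{r,j}(s,f,\varepsilon):=\{(x,y)\in\mathbb R^n\times(0,\infty):\Delta_rf(x,y)/y^s>\varepsilon,\ y\in(2^{-j-1},2^{-j}]\}$. Hyperbolic metric on $\mathbb R^{n+1}_+=\mathbb R^n\times(0,\infty)$: $\rho(\mathbf x,\mathbf y)=\operatorname{arccosh}(1+\frac{|\mathbf x-\mathbf y|^2}{2x_{n+1}y_{n+1}})$; for $A\subset\mathbb R^{n+1}_+$ and $R>0$, $A_R:=\{\mathbf x\in\mathbb R^{n+1}_+:\inf_{\mathbf y\in A}\rho(\mathbf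 x,\mathbf y)<R\}$. *)

(* Defs.v *)
From HB Require Import structures.
From mathcomp Require Import all_boot all_order all_algebra.
From mathcomp Require Import all_classical all_reals all_analysis.
Set Implicit Arguments. Unset Strict Implicit. Unset Printing Implicit Defensive.
Import Order.TTheory GRing.Theory Num.Theory.
Import numFieldNormedType.Exports.
Local Open Scope classical_set_scope.
Local Open Scope ring_scope.

Section Defs.
Variables (R : realType) (n : nat).
Notation V := 'rV[R]_n.

(* Euclidean norm |x| on R^n (the default norm on 'rV is the max norm) *)
Definition enorm (x : V) : R := Num.sqrt (\sum_(i < n) (x ord0 i) ^+ 2).

Definition Delta1 (h : V) (f : V -> R) : V -> R :=
  fun x => f (x + 2^-1 *: h) - f (x - 2^-1 *: h).

Fixpoint Deltak (k : nat) (h : V) (f : V -> R) : V -> R :=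
  match k with
  | 0 => f
  | k'.+1 => Deltak k' h (Delta1 h f)
  end.

Definition DeltaSup (k : nat) (f : V -> R) (x : V) (y : R) : R :=
  sup [set `|Deltak k h f x| | h in [set h : V | enorm h = y]].

(* floor s as a natural number (used for s > 0) *)
Definition floorn (s : R) : nat := `|Num.floor s|%N.

Definition Lambda (s : R) (f : V -> R) : Prop :=
  continuous f /\
  (exists M : R, forall x, `|f x| <= M) /\
  (exists C : R, forall x y, 0 < y <= 1 ->
      DeltaSup (floorn s).+1 f x y / y `^ s <= C).

(* S_{r,j}(s,f,eps), j an integer (j-1 may be -1) *)
Definition Sset (r : nat) (j : int) (s : R) (f : V -> R) (eps : R)
  : set (V * R) :=
  [set p | 0 < p.2 /\ DeltaSup r f p.1 p.2 / p.2 `^ s > eps /\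
           2 `^ (- (j%:~R + 1)) < p.2 <= 2 `^ (- j%:~R)].

Definition arccosh (u : R) : R := ln (u + Num.sqrt (u ^+ 2 - 1)).

Definition hdist2 (p q : V * R) : R :=
  (enorm (p.1 - q.1)) ^+ 2 + (p.2 - q.2) ^+ 2.

(* hyperbolic metric on the upper half space *)
Definition hrho (p q : V * R) : R :=
  arccosh (1 + hdist2 p q / (2 * p.2 * q.2)).

Definition hnbhd (A : set (V * R)) (rad : R) : set (V * R) :=
  [set p | 0 < p.2 /\
     (ereal_inf [set (hrho p q)%:E | q in A] < rad%:E)%E].

End Defs.

(* Main.v *)
(** The pure differences of order [N = floor s + 1] of [f] are [O(|h|^s)] at
    all scales. By Kemperman's identity every mixed difference of order at
    least [N] with steps of length at most [y] is then [O(y^s)], and Marchaud's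
    telescoping argument upgrades this: if moreover one step has length at most
    [eta * y], the difference is [o(1) y^s] as [eta -> 0], uniformly in [y].
    Moving [(x, h)] to a hyperbolically close [(x', (y'/y) h)] changes the
    [r]-th difference by a sum of differences with one such small step, which
    is absorbed by the gap between [eps] and [eps1]. *)

Require Import Defs.
From HB Require Import structures.
From mathcomp Require Import all_boot all_order all_algebra.
From mathcomp Require Import all_classical all_reals all_analysis.
From mathcomp Require Import ring lra.
Import Order.TTheory GRing.Theory Num.Theory.
Import numFieldNormedType.Exports.
Local Open Scope classical_set_scope.
Local Open Scope ring_scope.

(** * Iterated forward differences along lists of steps *)

Section Differences.
Variables (R : realType) (V : normedModType R).
Implicit Types (f g : V -> R) (h u x : V) (L : seq V).

Definition fdiff h f : V -> R := fun x => f (x + h) - f x.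

Definition fdiffs L f : V -> R := foldr fdiff f L.

Lemma fdiffC h u f : fdiff h (fdiff u f) = fdiff u (fdiff h f).
Proof. by apply/funext => x; rewrite /fdiff (addrAC x h u); ring. Qed.

Lemma fdiffs_cat L1 L2 f : fdiffs (L1 ++ L2) f = fdiffs L1 (fdiffs L2 f).
Proof. exact: foldr_cat. Qed.

Lemma fdiffs_fdiff L h f : fdiffs L (fdiff h f) = fdiff h (fdiffs L f).
Proof. by elim: L => //= u L ->; rewrite fdiffC. Qed.

Lemma fdiffsC L1 L2 f : fdiffs L1 (fdiffs L2 f) = fdiffs L2 (fdiffs L1 f).
Proof. by elim: L2 => //= u L ih; rewrite fdiffs_fdiff ih. Qed.

Lemma fdiffs_cat_cons L1 h L2 f :
  fdiffs (L1 ++ h :: L2) f = fdiff h (fdiffs (L1 ++ L2) f).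
Proof. by rewrite !fdiffs_cat /= fdiffs_fdiff. Qed.

Lemma fdiffs_shift L f c x : fdiffs L (fun z => f (z + c)) x = fdiffs L f (x + c).
Proof.
elim: L x => //= u L ih x; rewrite /fdiff !ih.
by rewrite (addrAC x u c).
Qed.

Lemma fdiff_le h f B x : (forall z, `|f z| <= B) -> `|fdiff h f x| <= 2 * B.
Proof.
move=> fB; rewrite /fdiff (le_trans (ler_normB _ _))//.
by have := fB (x + h); have := fB x; lra.
Qed.

Lemma fdiffs_le L f B x :
  (forall z, `|f z| <= B) -> `|fdiffs L f x| <= 2 ^+ size L * B.
Proof.
move=> fB; elim: L x => [|u L ih] x /=; first by rewrite expr0 mul1r.
by rewrite exprS -mulrA fdiff_le.
Qed.

Lemma fdiffs_mem0 L f x : 0 \in L -> fdiffs L f x = 0.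
Proof.
elim: L x => //= u L ih x; rewrite inE => /orP[/eqP<-|L0].
  by rewrite /fdiff addr0 subrr.
by rewrite /fdiff !ih// subrr.
Qed.

(** For [k <= N] these are the signed binomial coefficients, built by Pascal's rule. That [c 0] has
    modulus 1 lets the term [k = 0] be isolated in Kemperman's argument. *)
Lemma fdiffs_nseq_expansion N : exists c : nat -> R, `|c 0%N| = 1 /\
  forall d f x, fdiffs (nseq N d) f x =
    \sum_(k < N.+1) c k * f (x + k%:R *: d).
Proof.
elim: N => [|N [c [c0 cE]]].
  exists (fun=> 1); split=> [|d f x]; first by rewrite normr1.
  by rewrite big_ord1 scale0r addr0 mul1r.
exists (fun k => (if k is k'.+1 then c k' else 0) -
                 (if (k < N.+1)%N then c k else 0)); split.
  by rewrite /= sub0r normrN.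
move=> d f x /=; rewrite /fdiff !cE.
under [RHS]eq_bigr do rewrite mulrBl.
rewrite sumrB; congr (_ - _).
  rewrite [RHS]big_ord_recl /= mul0r add0r; apply: eq_bigr => i _.
  by rewrite /bump /= add1n -addrA -nat1r scalerDl scale1r.
rewrite [RHS]big_ord_recr /= ltnn mul0r addr0; apply: eq_bigr => i _.
by rewrite ltn_ord.
Qed.

(* Each vector of the list moves linearly with [k]; expanding the outer
   differences leaves differences of [f] along arithmetic progressions. *)
Lemma fdiffs_progression_le f (N M m : nat) (c : nat -> R) (B y : R)
    (P : seq (V * V)) (x d : V) :
  (forall z w, `|w| <= M%:R * y ->
    `|\sum_(k < N.+1) c k * f (z + k%:R *: w)| <= B) ->
  (forall p, p \in P -> `|p.2| <= y) -> `|d| <= m%:R * y ->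
  (m + size P <= M)%N -> 0 <= y ->
  `|\sum_(k < N.+1)
      c k * fdiffs [seq p.1 + k%:R *: p.2 | p <- P] f (x + k%:R *: d)|
    <= 2 ^+ size P * B.
Proof.
move=> fB + + + y0; elim: P m x d => [|[a b] P ih] m x d Py dy mM /=.
  rewrite expr0 mul1r fB// (le_trans dy)// ler_wpM2r// ler_nat.
  by rewrite addn0 in mM.
have Py' p : p \in P -> `|p.2| <= y by move=> pP; apply: Py; rewrite inE pP orbT.
have by_ : `|b| <= y by apply: (Py (a, b)); rewrite inE eqxx.
under eq_bigr => k _.
  rewrite /fdiff mulrBr.
  have -> : x + k%:R *: d + (a + k%:R *: b) = (x + a) + k%:R *: (d + b).
    by rewrite scalerDr addrACA.
  over.
rewrite sumrB (le_trans (ler_normB _ _))// exprS -mulrA.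
(* Peeling off [(a, b)] may add [b] to the direction [d]: [m] grows by at most one while [P] loses
   one element, so [m + size P <= M] is preserved. *)
have h1 := ih m.+1 (x + a) (d + b) Py'.
have h2 := ih m x d Py' dy.
have {}h1 := h1 _ _; have {}h2 := h2 _.
rewrite mulr2n mulrDl mul1r lerD//; [apply: h1|apply: h2].
- rewrite (le_trans (ler_normD _ _))// -natr1 mulrDl mul1r; exact: lerD.
- by move: mM; rewrite /= addnS addSn.
- by rewrite (leq_trans _ mM)//= leq_add2l.
Qed.

(* Kemperman's argument: with [L_j - (k/j) L_j] as moving vectors, all terms
   [1 <= k <= N] of the progression vanish. *)
Lemma fdiffs_le_pure f (N : nat) (B y : R) L x :
  (forall z w, `|w| <= N%:R * y -> `|fdiffs (nseq N w) f z| <= B) ->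
  0 <= y -> size L = N -> (forall h, h \in L -> `|h| <= y) ->
  `|fdiffs L f x| <= 2 ^+ N * B.
Proof.
move=> fB y0 sL Ly; have [c [c0 cE]] := fdiffs_nseq_expansion N.
pose P := [seq (nth 0 L j, - (j.+1%:R^-1) *: nth 0 L j) | j <- iota 0 N].
have sP : size P = N by rewrite size_map size_iota.
have := @fdiffs_progression_le f N N 0 c B y P x 0.
rewrite sP normr0 mul0r add0n => /(_ _ _ (lexx _) (leqnn _) y0).
rewrite big_ord_recl big1 => [|k _]; last first.
  rewrite fdiffs_mem0 ?mulr0//.
  apply/mapP; exists (nth 0 L k, - (k.+1%:R^-1) *: nth 0 L k).
    by apply/mapP; exists (k : nat) => //; rewrite mem_iota add0n ltn_ord.
  rewrite /= /bump /= add1n scalerA mulrN divff ?pnatr_eq0// scaleN1r.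
  by rewrite subrr.
rewrite addr0 normrM c0 mul1r scaler0 addr0.
have -> : [seq p.1 + (@ord0 N)%:R *: p.2 | p <- P] = L.
  rewrite -map_comp -[RHS](mkseq_nth 0) sL; apply: eq_map => j /=.
  by rewrite scale0r addr0.
apply.
- by move=> z w wy; rewrite -cE fB.
- move=> p /mapP[j]; rewrite mem_iota add0n => /= jN -> /=.
  have jL : `|nth 0 L j| <= y by rewrite Ly// mem_nth// sL.
  rewrite normrZ normrN ger0_norm ?invr_ge0//.
  rewrite (le_trans _ jL)// ler_piMl// invf_le1 ?ltr0n// ler1n//.
Qed.

(** Telescoping writes the difference with step [m u] as the sum of [fdiff u f (x + i u)] over
    [i < m]; each term deviates from [fdiff u f x] by a second difference. *)
Lemma fdiff_natmul u (m : nat) f x :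
  m%:R * fdiff u f x =
    fdiff (m%:R *: u) f x - \sum_(i < m) fdiff (i%:R *: u) (fdiff u f) x.
Proof.
elim: m => [|m ih]; first by rewrite big_ord0 mul0r /fdiff scale0r addr0; ring.
rewrite big_ord_recr /= -natr1 mulrDl mul1r ih /fdiff scalerDl scale1r.
rewrite -!addrA; ring.
Qed.

End Differences.

Arguments fdiff {R V} h f x.
Arguments fdiffs {R V} L f x.

(** * Mixed differences of order at least [N]: Kemperman bounds, Marchaud gain, stability under
    small moves *)

Section Smoothness.
Variables (R : realType) (V : normedModType R).
Variables (f : V -> R) (s K : R) (N : nat).
Hypotheses (s_gt0 : 0 < s) (K_ge0 : 0 <= K).
Hypothesis pure_le : forall (y : R) (w z : V), `|w| <= y ->
  `|fdiffs (nseq N w) f z| <= K * y `^ s.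
Implicit Types (h u x : V) (L : seq V) (y e : R).

(** Kemperman's argument bounds the first [N] differences by pure ones with steps up to [N y],
    whence the factor N^s; each of the other [k - N] differences at most doubles the bound. *)
Lemma fdiffs_smooth_le (k : nat) : exists2 A : R, 0 <= A &
  forall y L x, (N <= k)%N -> size L = k -> 0 <= y ->
    (forall h, h \in L -> `|h| <= y) -> `|fdiffs L f x| <= A * y `^ s.
Proof.
exists (2 ^+ (k - N) * (2 ^+ N * (K * N%:R `^ s))).
  by rewrite !mulr_ge0 ?exprn_ge0 ?powR_ge0.
move=> y L x Nk sL y0 Ly.
rewrite -(cat_take_drop N L) fdiffs_cat fdiffsC.
have <- : size (drop N L) = (k - N)%N by rewrite size_drop sL.
rewrite -!mulrA -powRM// fdiffs_le// => z.
apply: (fdiffs_le_pure _ _ _ _ _ y) => //.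
- by move=> w v; apply: pure_le.
- by rewrite size_take_min sL; apply/minn_idPl.
- by move=> h /mem_take; apply: Ly.
Qed.

(* Marchaud's argument, by descending induction on the number [a] of small
   steps: [m * fdiff u g] is [fdiff (m * u) g], which is merely bounded, up to
   second differences with one more small step. *)
Lemma fdiffs_small (a b : nat) : (0 < a)%N -> (N <= a + b)%N ->
  forall e, 0 < e -> exists2 eta : R, 0 < eta &
  forall y L1 L2 x, 0 < y -> size L1 = a -> size L2 = b ->
    (forall h, h \in L1 -> `|h| <= eta * y) ->
    (forall h, h \in L2 -> `|h| <= y) ->
    `|fdiffs (L1 ++ L2) f x| <= e * y `^ s.
Proof.
have [d] := ubnP (N - a)%N; elim: d a => // d ih a; rewrite ltnS => Nad a0 Nab e e0.
have [Na|aN] := leqP N a.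
  have [A A0 AP] := fdiffs_smooth_le a.
  pose A' := 2 ^+ b * A; have A'0 : 0 <= A' by rewrite mulr_ge0 ?exprn_ge0.
  have eA0 : 0 < e / (A' + 1) by rewrite divr_gt0// ltr_wpDl.
  (* With at least [N] small steps, the order-[a] bound at scale [eta * y] gains the factor eta^s,
     and this choice makes A' eta^s at most [e]. The [+ 1] guards against [A' = 0]. *)
  exists ((e / (A' + 1)) `^ s^-1); first exact: powR_gt0.
  move=> y L1 L2 x y0 sL1 sL2 L1y L2y.
  rewrite fdiffs_cat fdiffsC.
  have := fdiffs_le R V L2 (fdiffs L1 f) _ x
    (fun z => AP _ L1 z Na sL1 (mulr_ge0 (powR_ge0 _ _) (ltW y0)) L1y).
  rewrite (powRM s (powR_ge0 _ _) (ltW y0)) -powRrM mulVf ?gt_eqF// (powRr1 (ltW eA0)) sL2.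
  move=> /le_trans; apply; rewrite !mulrA -/A' ler_wpM2r ?powR_ge0//.
  rewrite ler_pdivrMr ?ltr_wpDl//; nra.
have [A A0 AP] := fdiffs_smooth_le (a + b).
have [] := ih a.+1 _ _ _ (e / 2) _; rewrite ?divr_gt0//.
- by rewrite (leq_trans _ Nad)// ltn_sub2l.
- by rewrite (leq_trans Nab)// leq_add2r.
move=> eta eta0 etaP.
(* Large enough that the bounded term [A], once divided by [m], costs at most [e / 2]; the second
   differences cost the other half. *)
pose m := (Num.truncn (2 * A / e)).+1.
have m0 : 0 < m%:R :> R by rewrite ltr0n.
have mA : A <= m%:R * (e / 2).
  have : 2 * A / e < m%:R by exact: truncnS_gt.
  by rewrite ltr_pdivrMr// => ?; nra.
(* With small steps of length at most [t / m * y], every multiple [i u] with [i <= m] has length at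
   most [t * y]: small enough for the induction hypothesis, and at most [y] for the crude bound. *)
pose t := Num.min eta 1.
have t0 : 0 < t by rewrite lt_min eta0 ltr01.
have m1 : 1 <= m%:R :> R by rewrite ler1n.
exists (t / m%:R); first by rewrite divr_gt0.
move=> y [|u L1] L2 x y0 sL1 sL2 L1y L2y; first by rewrite -sL1 in a0.
have tm : t / m%:R <= t by rewrite ler_pdivrMr// ler_peMr// ltW.
have teta : t <= eta by rewrite ge_min lexx.
have t1 : t <= 1 by rewrite ge_min lexx orbT.
have mu : `|m%:R *: u| <= t * y.
  have := L1y u (mem_head _ _).
  by rewrite normrZ normr_nat mulrAC ler_pdivlMr// mulrC.
have L1t h : h \in u :: L1 -> `|h| <= t * y.
  by move=> /L1y/le_trans; apply; rewrite ler_wpM2r// ltW.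
have ty : t * y <= y by rewrite ler_piMl// ltW.
have tey : t * y <= eta * y by rewrite ler_wpM2r// ltW.
have ys0 : 0 <= y `^ s by exact: powR_ge0.
rewrite -(ler_pM2l m0) -[X in X * `|_|]normr_nat -normrM cat_cons /= fdiff_natmul.
rewrite (le_trans (ler_normB _ _))//.
have h1 : `|fdiff (m%:R *: u) (fdiffs (L1 ++ L2) f) x| <= A * y `^ s.
  apply: (AP y ((m%:R *: u) :: (L1 ++ L2))) => //.
  - by rewrite /= size_cat -addSn sL2; congr (_ + _)%N.
  - exact: ltW.
  - move=> h; rewrite inE mem_cat => /or3P[/eqP->|hL1|]; last exact: L2y.
      exact: le_trans ty.
    by rewrite (le_trans _ ty)// L1t// inE hL1 orbT.
have h2 : `|\sum_(i < m) fdiff (i%:R *: u) (fdiff u (fdiffs (L1 ++ L2) f)) x|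
    <= m%:R * (e / 2 * y `^ s).
  rewrite (le_trans (ler_norm_sum _ _ _))//.
  rewrite mulr_natl -[X in _ <= _ *+ X]card_ord -sumr_const; apply: ler_sum => i _.
  apply: (etaP y [:: i%:R *: u, u & L1] L2) => //.
  - by rewrite /= -sL1.
  - move=> h; rewrite inE => /orP[/eqP->|/L1t/le_trans]; last exact.
    rewrite (le_trans _ tey)// (le_trans _ mu)// !normrZ !normr_nat.
    by rewrite ler_wpM2r// ler_nat ltnW.
have := lerD h1 h2; move/le_trans; apply.
by have := ler_wpM2r ys0 mA; lra.
Qed.

(** The steps [h + u] are exchanged for [h] one at a time. Each exchange leaves a difference with
    step [u], since [fdiff (h + u) g x - fdiff h g x = fdiff u g (x + h)]. *)
Lemma fdiffs_nseq_swap (r i : nat) h u L x e :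
  (forall L' z, (forall k, k \in L' -> k \in [:: h, h + u & L]) ->
     (size L').+1 = r -> `|fdiff u (fdiffs L' f) z| <= e) ->
  (i + size L = r)%N ->
  `|fdiffs (nseq i (h + u) ++ L) f x - fdiffs (nseq i h ++ L) f x| <= i%:R * e.
Proof.
elim: i L => [|i ih] L ue sL; first by rewrite subrr normr0 mul0r.
have -> : fdiffs (nseq i.+1 (h + u) ++ L) f = fdiffs (nseq i (h + u) ++ (h + u) :: L) f.
  by rewrite fdiffs_cat_cons.
rewrite -(subrKA (fdiffs (nseq i h ++ (h + u) :: L) f x)).
rewrite -natr1 mulrDl mul1r (le_trans (ler_normD _ _))// lerD//.
  apply: ih; last by rewrite /= -sL addnS.
  move=> L' z L'P sL'; apply: ue => // k /L'P.
  by rewrite !inE => /or4P[]->; rewrite ?orbT.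
rewrite fdiffs_cat_cons /=.
have -> g : fdiff (h + u) g x - fdiff h g x = fdiff u g (x + h).
  by rewrite /fdiff addrA; ring.
apply: ue; last by rewrite size_cat size_nseq -sL.
move=> k; rewrite mem_cat !inE => /orP[/nseqP[-> _]|->]; rewrite ?eqxx ?orbT//.
Qed.

Lemma fdiffs_nseq_uniform (r : nat) : (0 < r)%N -> (N <= r)%N ->
  forall e, 0 < e -> exists2 eta : R, 0 < eta &
  forall y h u v x, 0 < y -> `|h| <= y -> `|u| <= eta * y -> `|v| <= eta * y ->
    `|fdiffs (nseq r (h + u)) f (x + v) - fdiffs (nseq r h) f x| <= e * y `^ s.
Proof.
(* There are [r] errors from exchanging steps and two from moving the base point by [v]; 2^s
   accounts for working at scale [2 * y], which bounds [h + u]. *)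
move=> r0 Nr e e0; set e' := e / (r%:R + 2) / 2 `^ s.
have e'0 : 0 < e' by rewrite !divr_gt0 ?powR_gt0// ltr_wpDl.
have := fdiffs_small 1 r.-1 isT; rewrite add1n prednK// => /(_ Nr _ e'0)[eta eta0 etaP].
pose t := Num.min eta 1.
have t0 : 0 < t by rewrite lt_min eta0 ltr01.
exists t => // y h u v x y0 hy uy vy.
have y20 : 0 < 2 * y by rewrite mulr_gt0.
have teta : t * y <= eta * (2 * y).
  have : t * y <= eta * y by rewrite ler_pM2r// ge_min lexx.
  by have := mulr_gt0 eta0 y0; lra.
have t1 : t * y <= y by rewrite ler_piMl ?(ltW y0)// ge_min lexx orbT.
have small w L z : `|w| <= t * y -> (size L).+1 = r ->
    (forall k, k \in L -> `|k| <= 2 * y) ->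
    `|fdiff w (fdiffs L f) z| <= e' * (2 * y) `^ s.
  move=> wt sL Ly; apply: (etaP (2 * y) [:: w] L) => //; first by rewrite -sL.
  by move=> k; rewrite inE => /eqP->; exact: le_trans teta.
rewrite -(subrKA (fdiffs (nseq r h) f (x + v))) (le_trans (ler_normD _ _))//.
have e'E : e * y `^ s = r%:R * (e' * (2 * y) `^ s) + 2 * (e' * (2 * y) `^ s).
  have p2 : 2 `^ s != 0 :> R by rewrite gt_eqF ?powR_gt0.
  have r2 : r%:R + 2 != 0 :> R by rewrite gt_eqF ?ltr_wpDl.
  by rewrite powRM ?(ltW y0)// /e'; field; rewrite p2.
rewrite e'E lerD//.
  have := @fdiffs_nseq_swap r r h u [::] (x + v) (e' * (2 * y) `^ s).
  rewrite !cats0 addn0; apply=> // L z LP sL; apply: small => // k /LP.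
  rewrite !inE => /orP[]/eqP->; first by move: hy (normr_ge0 h); lra.
  by rewrite (le_trans (ler_normD _ _))//; lra.
(* Of the [r] differences with step [h], one is estimated trivially, giving the factor 2; the other
   [r - 1] together with the small step [v] form a difference of order [r]. *)
case: (r) r0 small => // q _ small.
have -> g : g (x + v) - g x = fdiff v g x by [].
rewrite /= fdiffC; apply: fdiff_le => z; apply: small => //.
  by rewrite size_nseq.
by move=> k /nseqP[-> _]; move: hy (normr_ge0 h); lra.
Qed.

End Smoothness.

(** * Euclidean norm, central differences, and Euclidean control from the hyperbolic metric *)

Section EuclideanSpace.
Variables (R : realType) (n : nat).
Local Notation V := 'rV[R]_n.
Implicit Types (f : V -> R) (x h w z : V) (y s eta : R).

Lemma enorm_ge0 x : 0 <= enorm x.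
Proof. exact: sqrtr_ge0. Qed.

Lemma norm_le_enorm x : `|x| <= enorm x.
Proof.
have [->|] := eqVneq `|x| 0; first exact: enorm_ge0.
move=> /(@mx_norm_neq0 R 1 n x)[[i j]] /= xE.
have -> : `|x| = `|x i j| by exact: xE.
rewrite ord1 -sqrtr_sqr ler_wsqrtr// (bigD1 j)//= lerDl.
by apply: sumr_ge0 => k _; exact: sqr_ge0.
Qed.

Lemma enorm_le_norm x : enorm x <= Num.sqrt n%:R * `|x|.
Proof.
have xj (j : 'I_n) : `|x ord0 j| <= `|x|.
  have -> : `|x| = \big[Num.max/0]_ij `|x ij.1 ij.2| by exact: mx_normrE.
  exact: (@le_bigmax _ _ _ 0 (fun ij : 'I_1 * 'I_n => `|x ij.1 ij.2|) (ord0, j)).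
rewrite -{1}[`|x|]ger0_norm// -sqrtr_sqr -sqrtrM ?ler0n// ler_wsqrtr//.
have -> : n%:R * `|x| ^+ 2 = \sum_(i < n) `|x| ^+ 2.
  by rewrite sumr_const card_ord mulr_natl.
by apply: ler_sum => j _; rewrite -real_normK ?num_real// lerXn2r ?nnegrE.
Qed.

Lemma enormZ (c : R) x : enorm (c *: x) = `|c| * enorm x.
Proof.
rewrite /enorm -sqrtr_sqr -sqrtrM ?sqr_ge0// mulr_sumr; congr Num.sqrt.
by apply: eq_bigr => i _; rewrite mxE exprMn.
Qed.

(** Each central difference is a forward difference translated by [- h / 2], so [k] of them shift
    the base point by [- (k / 2) h]. *)
Lemma Deltak_fdiffs (k : nat) h f x :
  Deltak k h f x = fdiffs (nseq k h) f (x - (k%:R / 2) *: h).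
Proof.
elim: k f x => [|k ih] f x /=; first by rewrite mul0r scale0r subr0.
have -> : Delta1 h f = fun z => fdiff h f (z + - (2^-1 *: h)).
  apply/funext => z; rewrite /Delta1 /fdiff; congr (f _ - _).
  rewrite addrAC -addrA; congr (z + _); apply/eqP.
  rewrite eq_sym subr_eq -scalerDl (_ : 2^-1 + 2^-1 = 1) ?scale1r//.
  by field.
rewrite ih fdiffs_shift fdiffs_fdiff; congr fdiff.
by rewrite -addrA -opprD -scalerDl -[k.+1%:R]natr1; congr (x - _ *: h); field.
Qed.

Lemma Deltak_has_ubound (k : nat) f x y : (exists M, forall z, `|f z| <= M) ->
  has_ubound [set `|Deltak k h f x| | h in [set h : V | enorm h = y]].
Proof.
move=> [M fM]; exists (2 ^+ k * M) => _ [h _ <-].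
by rewrite Deltak_fdiffs (le_trans (fdiffs_le _ _ _ _ M _ fM))// size_nseq.
Qed.

(** The seminorm in [Lambda] handles Euclidean step lengths in (0, 1]; beyond 1 the boundedness of
    [f] suffices, as the s-th power of the length is at least 1. The factor with [Num.sqrt n] passes
    from the Euclidean norm to the max norm. *)
Lemma Lambda_fdiffs_le s f : 0 < s -> Lambda s f -> exists2 K, 0 <= K &
  forall y w z, `|w| <= y ->
    `|fdiffs (nseq (floorn s).+1 w) f z| <= K * y `^ s.
Proof.
move=> s0 [_ [fb [C fC]]]; have [M fM] := fb; set N := (floorn s).+1.
have K0 : 0 <= `|C| + 2 ^+ N * `|M| by rewrite addr_ge0 ?mulr_ge0 ?exprn_ge0.
exists ((`|C| + 2 ^+ N * `|M|) * (Num.sqrt n%:R) `^ s).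
  by rewrite mulr_ge0 ?powR_ge0.
move=> y w z wy; have y0 : 0 <= y by exact: le_trans wy.
suff /le_trans : `|fdiffs (nseq N w) f z| <=
    (`|C| + 2 ^+ N * `|M|) * enorm w `^ s.
  apply; rewrite -mulrA -powRM ?sqrtr_ge0// ler_wpM2l//.
  apply: ge0_ler_powR; rewrite ?nnegrE ?enorm_ge0 ?mulr_ge0 ?sqrtr_ge0 ?(ltW s0)//.
  by rewrite (le_trans (enorm_le_norm w))// ler_wpM2l// sqrtr_ge0.
have [w0|wn0] := eqVneq w 0.
  by rewrite w0 fdiffs_mem0 ?mem_nseq ?eqxx// normr0 mulr_ge0 ?powR_ge0.
have t0 : 0 < enorm w by rewrite (lt_le_trans _ (norm_le_enorm w))// normr_gt0.
have [t1|t1] := leP (enorm w) 1.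
  have zE : z = (z + (N%:R / 2) *: w) - (N%:R / 2) *: w by rewrite addrK.
  rewrite zE -Deltak_fdiffs; set x := z + _.
  apply: (@le_trans _ _ (DeltaSup N f x (enorm w))).
    by apply: ub_le_sup; [exact: Deltak_has_ubound|exists w].
  have := fC x (enorm w); rewrite t0 t1 => /(_ isT).
  rewrite ler_pdivrMr ?powR_gt0// => /le_trans; apply.
  rewrite ler_wpM2r ?powR_ge0// (le_trans (ler_norm C))// lerDl.
  by rewrite mulr_ge0 ?exprn_ge0.
rewrite (le_trans (fdiffs_le _ _ _ _ `|M| _ _))//.
  by move=> v; rewrite (le_trans (fM v))// ler_norm.
rewrite size_nseq -[leLHS]mulr1 ler_pM ?mulr_ge0 ?exprn_ge0 ?lerDr//.
rewrite (_ : 1 = 1 `^ s); last by rewrite powR1.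
apply: ge0_ler_powR; rewrite ?nnegrE ?enorm_ge0 ?(ltW s0)//.
exact: ltW.
Qed.

(** Since arccosh(1 + t) >= ln(1 + t), the hypothesis forces t < eta^2 / 8, so the squared Euclidean
    distance is below [eta ^+ 2 * p.2 * q.2 / 4]; it remains to bound [p.2] by a multiple of
    [q.2]. *)
Lemma hrho_lt_dist (p q : V * R) eta : 0 < p.2 -> 0 < q.2 -> 0 < eta <= 1 ->
  hrho p q < ln (1 + eta ^+ 2 / 8) ->
  enorm (p.1 - q.1) <= eta * q.2 /\ `|p.2 - q.2| <= eta * q.2.
Proof.
move=> p0 q0 /andP[e0 e1]; rewrite /hrho /arccosh.
set D := hdist2 p q; set t := D / _ => tlt.
have D1 : 0 <= enorm (p.1 - q.1) ^+ 2 by exact: sqr_ge0.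
have D2 : 0 <= (p.2 - q.2) ^+ 2 by exact: sqr_ge0.
have pq0 : 0 < 2 * p.2 * q.2 by rewrite !mulr_gt0.
have t0 : 0 <= t by rewrite divr_ge0 ?(ltW pq0)// addr_ge0.
have sq0 := sqrtr_ge0 ((1 + t) ^+ 2 - 1).
have e20 : 0 < eta ^+ 2 by rewrite exprn_gt0.
move: tlt; rewrite ltr_ln ?posrE; [|lra|lra] => tlt.
have {}tlt : t < eta ^+ 2 / 8 by lra.
move: tlt; rewrite /t ltr_pdivrMr// => Dlt.
have e21 : eta ^+ 2 <= 1 by rewrite expr_le1 ?(ltW e0).
(* Otherwise the vertical gap exceeds [3 / 4 * p.2], while the squared distance is below
   [p.2 ^+ 2 / 16]. *)
have p4q : p.2 <= 4 * q.2.
  rewrite leNgt; apply/negP => qp.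
  have : D < p.2 ^+ 2 / 16.
    apply: (lt_le_trans Dlt).
    have : eta ^+ 2 * (p.2 * q.2) <= 1 * (p.2 * q.2).
      by rewrite ler_wpM2r// mulr_ge0 ?(ltW p0) ?(ltW q0).
    nra.
  rewrite /D /hdist2; nra.
have DE : D <= (eta * q.2) ^+ 2.
  apply: (le_trans (ltW Dlt)).
  have : eta ^+ 2 * q.2 * p.2 <= eta ^+ 2 * q.2 * (4 * q.2).
    by rewrite ler_wpM2l// mulr_ge0 ?(ltW e20) ?(ltW q0).
  rewrite exprMn; nra.
have eq0 : 0 <= eta * q.2 by rewrite mulr_ge0 ?(ltW e0) ?(ltW q0).
rewrite /D /hdist2 in DE.
split; rewrite -ler_sqr ?nnegrE ?enorm_ge0 ?normr_ge0//; first lra.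
by rewrite real_normK ?num_real//; lra.
Qed.

End EuclideanSpace.

(** * Dyadic layers and the inclusion of hyperbolic neighbourhoods *)

Lemma pow2_half (R : realType) (a : R) : 2 `^ (- (a + 1)) = 2 `^ (- a) / 2 :> R.
Proof.
by rewrite opprD powRD ?pnatr_eq0 ?implybT// powRN powRN powRr1.
Qed.

(** With a = 2^(-j), [y] in (a/2, a] forces [z] into (a/4, 2a], which the three layers tile
    exactly. *)
Lemma dyadic_neighbours (R : realType) (j : int) (y z : R) :
  2 `^ (- (j%:~R + 1)) < y <= 2 `^ (- j%:~R) -> y / 2 <= z <= 2 * y ->
  [\/ 2 `^ (- ((j - 1)%:~R + 1)) < z <= 2 `^ (- (j - 1)%:~R),
      2 `^ (- (j%:~R + 1)) < z <= 2 `^ (- j%:~R) |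
      2 `^ (- ((j + 1)%:~R + 1)) < z <= 2 `^ (- (j + 1)%:~R)].
Proof.
have E0 := pow2_half R ((j - 1)%:~R).
have jE : (j - 1)%:~R + 1 = j%:~R :> R by rewrite rmorphB /= subrK.
have E2 := pow2_half R ((j + 1)%:~R).
have j1E : (j + 1)%:~R = j%:~R + 1 :> R by rewrite rmorphD.
rewrite jE in E0 *; rewrite j1E in E2 *; rewrite E2 (pow2_half R j%:~R) {E2}.
move: E0; set a := 2 `^ (- j%:~R); set b := 2 `^ _ => ab.
move=> /andP[y1 y2] /andP[z1 z2].
have [az|za] := ltP a z; first by apply: Or31; apply/andP; lra.
have [az|za'] := ltP (a / 2) z; first by apply: Or32.
by apply: Or33; apply/andP; lra.
Qed.

Theorem mainTheorem4 (R : realType) (n : nat) (s : R) (r : nat)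
  (f : 'rV[R]_n -> R) (eps eps1 : R) :
  0 < s -> s < r%:R -> Lambda s f -> 0 < eps1 -> eps1 < eps ->
  exists delta : R, 0 < delta /\
    forall j : nat,
      hnbhd (Sset r j%:Z s f eps) delta `<=`
        Sset r (j%:Z - 1) s f eps1 `|` Sset r j%:Z s f eps1
          `|` Sset r (j%:Z + 1) s f eps1.
Proof.
move=> s0 sr fL e10 e1e; have fb := fL.2.1.
have [K K0 fK] := Lambda_fdiffs_le _ _ _ _ s0 fL.
have Nr : ((floorn s).+1 <= r)%N.
  rewrite -ltz_nat /floorn gez0_abs ?floor_ge0 ?(ltW s0)//.
  by rewrite floor_lt_int.
have r0 : (0 < r)%N by exact: leq_trans Nr.
(* Half of the gap pays for changing the difference; the other half, encoded in the ratio [b] below,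
   pays for changing the weight from q.2^s to p.2^s. *)
have e0 : 0 < (eps - eps1) / 2 by lra.
have [eta0 eta0_gt0 etaP] :=
  fdiffs_nseq_uniform _ _ f s K _ s0 K0 fK r r0 Nr _ e0.
pose b := (eps + eps1) / 2 / eps1.
have b1 : 1 < b by rewrite ltr_pdivlMr//; lra.
have bs1 : 1 < b `^ s^-1.
  rewrite (_ : 1 = 1 `^ s^-1); last by rewrite powR1.
  apply: gt0_ltr_powR; rewrite ?invr_gt0 ?nnegrE//.
  by lra.
pose c : R := 1 + r%:R / 2.
have c0 : 1 <= c by rewrite lerDl divr_ge0.
(* The three bounds serve, in order, to make the moves [u] and [v] admissible, to keep [p.2] within
   a factor 2 of [q.2], and to ensure that p.2^s is at most b q.2^s. *)
pose eta := Num.min (eta0 / c) (Num.min 2^-1 (b `^ s^-1 - 1)).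
have eta_gt0 : 0 < eta.
  by rewrite !lt_min divr_gt0 ?(lt_le_trans _ c0)// invr_gt0 ltr0n subr_gt0.
have eta_c : c * eta <= eta0.
  by rewrite mulrC -ler_pdivlMr ?(lt_le_trans _ c0)// ge_min lexx.
have eta_half : eta <= 2^-1 by rewrite !ge_min lexx orbT.
have eta_b : eta <= b `^ s^-1 - 1 by rewrite !ge_min lexx !orbT.
exists (ln (1 + eta ^+ 2 / 8)); split.
  by rewrite ln_gt0// ltrDl divr_gt0// exprn_gt0.
move=> j p [p0 /ereal_inf_lt[_ [q [q0 [qeps qj]] <-]]].
rewrite lte_fin => /(hrho_lt_dist _ _ _ _ _ p0 q0)[|pq1 pq2].
  by rewrite eta_gt0/=; lra.
have pq2' : - (eta * q.2) <= p.2 - q.2 <= eta * q.2 by rewrite -ler_norml.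
have etaq : eta * q.2 <= 2^-1 * q.2 by rewrite ler_wpM2r ?(ltW q0).
have qs0 : 0 < q.2 `^ s by rewrite powR_gt0.
have ps0 : 0 < p.2 `^ s by rewrite powR_gt0.
suff peps : eps1 < DeltaSup r f p.1 p.2 / p.2 `^ s.
  have zj : q.2 / 2 <= p.2 <= 2 * q.2 by apply/andP; lra.
  have [pj|pj|pj] := dyadic_neighbours _ _ _ _ qj zj.
  - by left; left.
  - by left; right.
  - by right.
rewrite ltr_pdivlMr//; move: qeps; rewrite ltr_pdivlMr// => qeps.
have [h hq hgt] : exists2 h, enorm h = q.2 & eps * q.2 `^ s < `|Deltak r h f q.1|.
  have /sup_gt[] := qeps; last by move=> _ [h hq <-] ?; exists h.
  (* The set of steps of length [q.2] is empty when [n = 0]; its supremum is then 0 by convention,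
     contradicting [qeps]. *)
  apply/set0P/eqP => S0; move: qeps; rewrite /DeltaSup S0 sup0 ltNge.
  by rewrite mulr_ge0// ltW// (lt_trans e10).
(* Chosen so that [h + u] is [h] rescaled to length [p.2], hence a competitor in the supremum at
   [p]. *)
pose u := (p.2 / q.2 - 1) *: h.
have huE : h + u = (p.2 / q.2) *: h by rewrite /u scalerBl scale1r addrC subrK.
have hup : enorm (h + u) = p.2.
  by rewrite huE enormZ hq ger0_norm ?divfK ?gt_eqF// divr_ge0 ?(ltW p0) ?(ltW q0).
have hn : `|h| <= q.2 by rewrite -hq norm_le_enorm.
have un : `|u| <= eta * q.2.
  rewrite normrZ (le_trans (ler_wpM2l _ hn))//.
  have -> : `|p.2 / q.2 - 1| * q.2 = `|p.2 - q.2|; last exact: pq2.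
  rewrite -[X in _ * X](ger0_norm (ltW q0)) -normrM mulrBl mul1r.
  by rewrite divfK ?gt_eqF.
(* Displacement between the forward base points of the two central differences: the move of the
   centre, corrected for the change of step. Its size explains the constant [c]. *)
pose v := (p.1 - q.1) - (r%:R / 2) *: u.
have vn : `|v| <= eta0 * q.2.
  rewrite (le_trans (ler_normB _ _))// normrZ ger0_norm ?divr_ge0//.
  have := le_trans (norm_le_enorm _ _ _) pq1.
  have : r%:R / 2 * `|u| <= r%:R / 2 * (eta * q.2) by rewrite ler_wpM2l// divr_ge0.
  have := ler_wpM2r (ltW q0) eta_c; rewrite /c; lra.
have un0 : `|u| <= eta0 * q.2.
  rewrite (le_trans un)// ler_wpM2r ?(ltW q0)// (le_trans _ eta_c)//.
  by rewrite ler_peMl// ltW.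
have := etaP _ h u v (q.1 - (r%:R / 2) *: h) q0 hn un0 vn.
have -> : q.1 - (r%:R / 2) *: h + v = p.1 - (r%:R / 2) *: (h + u).
  by rewrite /v scalerDr opprD !addrA; congr (_ - _); rewrite addrAC (addrAC q.1) subrr add0r addrC.
rewrite -!Deltak_fdiffs => near_h.
have hgt' : (eps + eps1) / 2 * q.2 `^ s < `|Deltak r (h + u) f p.1|.
  have := lerB_dist (Deltak r h f q.1) (Deltak r (h + u) f p.1).
  rewrite distrC in near_h; lra.
have pb : p.2 <= b `^ s^-1 * q.2.
  by have := ler_wpM2r (ltW q0) eta_b; lra.
have psb : p.2 `^ s <= b * q.2 `^ s.
  rewrite -[b in leRHS]powRr1 ?(ltW (lt_trans ltr01 b1))//.
  rewrite -[1](@mulVf _ s) ?gt_eqF// powRrM -powRM ?powR_ge0 ?(ltW q0)//.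
  apply: ge0_ler_powR; rewrite ?nnegrE ?mulr_ge0 ?powR_ge0 ?(ltW p0) ?(ltW q0)//.
  exact: ltW.
apply: (@lt_le_trans _ _ `|Deltak r (h + u) f p.1|); last first.
  by apply: ub_le_sup; [exact: Deltak_has_ubound|exists (h + u)].
apply: le_lt_trans hgt'; rewrite (le_trans (ler_wpM2l (ltW e10) psb))//.
by rewrite mulrA (mulrC eps1) /b divfK ?gt_eqF.
Qed.
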